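(* Let $X$ be a $\mathbb{Z}$-subshift with positive topological entropy and let $v,w\in L(X)$ (the lengths $|v|$ and $|w|$ may differ). If $E_X(v)=E_X(w)$, then for every measure of maximal entropy $\mu$ of $X$, $$\mu(v)=\mu(w)\,e^{h_{top}(X)(|w|-|v|)}.$$
   Context: Let $\mathcal{A}$ be a finite alphabet; $\mathcal{A}^{\mathbb{Z}}$ has the product topology and shift maps $(\sigma_n x)_i=x_{i+n}$. A $\mathbb{Z}$-subshift is a (nonempty) closed set $X\subseteq\mathcal{A}^{\mathbb{Z}}$ with $\sigma_n(X)=X$ for all $n\in\mathbb{Z}$. For $n\ge 1$, $L_n(X)=\{x_{[0,n)}: x\in X\}$ is the set of words of length $n$ occurring in points of $X$, and $L(X)=\bigcup_{n\ge 1}L_n(X)$. For $w\in L_n(X)$, $|w|=n$ is its length and $[w]=\{x\in X: x_{[0,n)}=w\}$ its cylinder set. The topological entropy is $h_{top}(X)=\lim_{n\to\infty}\frac1n\log|L_n(X)|$. All measures are shift-invariant Borel probability measures on $X$, and $\mu(w):=\mu([w])$. The entropy of $\mu$ is $h_\mu(X)=\lim_{n\to\infty}\frac1n\sum_{w\in\mathcal{A}^n}-\mu(w)\log\mu(w)$, and $\mu$ is a measure of maximal entropy (MME) if $h_\mu(X)=h_{top}(X)$. Extender set: for $w\in L_n(X)$, $E_X(w)$ is the set of all bi-infinite sequences $y\in\mathcal{A}^{\mathbb{Z}}$ obtained from points $x\in[w]$ by deleting $w$ and concatenating the two sides: $y_i=x_i$ for $i<0$ and $y_i=x_{i+n}$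 for $i\ge 0$. With this identification, extender sets of words of different lengths can be compared. *)

(* Defs.v *)
From HB Require Import structures.
From mathcomp Require Import all_boot all_order all_algebra.
From mathcomp Require Import all_classical all_reals all_analysis.

Set Implicit Arguments.
Unset Strict Implicit.
Unset Printing Implicit Defensive.

Import Order.TTheory GRing.Theory Num.Theory.
Import numFieldNormedType.Exports.

Local Open Scope classical_set_scope.
Local Open Scope ring_scope.

Notation fullshift A := {ptws int -> discrete_topology A}.

Definition shift_map (A : finType) (n : int) (x : fullshift A) : fullshift A :=
  fun i => x (i + n).

Record subshift (A : finType) := Subshift {
  points :> set (fullshift A) ;
  subshift_neq0 : points !=set0 ;
  subshift_closed : closed points ;
  subshift_shift : forall n : int, [set shift_map n x | x in points] = points }.

(* Measures below live on X itself, not on the full shift; set_type carries the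
   topology induced by the product topology. *)
Definition subshift_space (A : finType) (X : subshift A) : Type :=
  set_type (points X).

HB.instance Definition _ (A : finType) (X : subshift A) :=
  Topological.copy (subshift_space X) (set_type (points X)).

Lemma subshift_space_inhabited (A : finType) (X : subshift A) :
  exists x : subshift_space X, True.
Proof.
have [x Xx] := subshift_neq0 X.
by exists (exist _ x (mem_set Xx)).
Qed.

(* Measurable types are required to be pointed. *)
HB.instance Definition _ (A : finType) (X : subshift A) :=
  isPointed.Build (subshift_space X) (sval (cid (subshift_space_inhabited X))).

Lemma shift_map_mem (A : finType) (X : subshift A) (n : int)
    (x : subshift_space X) :
  shift_map n (set_val x) \in points X.
Proof.
have Sx : [set shift_map n y | y in points X] (shift_map n (set_val x)).
  by exists (set_val x) => //; exact: set_mem (valP x).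
by apply/mem_set; rewrite (subshift_shift X n) in Sx.
Qed.

Definition subshift_map (A : finType) (X : subshift A) (n : int)
    (x : subshift_space X) : subshift_space X :=
  exist _ (shift_map n (set_val x)) (shift_map_mem n x).

Definition borel (A : finType) (X : subshift A) :=
  g_sigma_algebraType (@open (subshift_space X)).

Definition prefix_word (A : finType) (n : nat) (x : fullshift A) :
  n.-tuple A := [tuple (x (Posz i) : A) | i < n].

Definition lang (A : finType) (X : subshift A) (n : nat) : {set n.-tuple A} :=
  [set w | `[< exists2 x, points X x & prefix_word n x = w >] ]%SET.

Definition cylinder (A : finType) (X : subshift A) (n : nat) (w : n.-tuple A) :
  set (subshift_space X) := [set x | prefix_word n (set_val x) = w].

Arguments cylinder {A} X {n} w.

(* Removal of the block of length n at positions 0, ..., n - 1. *)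
Definition excise (A : finType) (n : nat) (x : fullshift A) : fullshift A :=
  fun i => if i < 0 then x i else x (i + Posz n).

Definition extender_set (A : finType) (X : subshift A) (n : nat)
    (w : n.-tuple A) : set (fullshift A) :=
  [set excise n (set_val x) | x in cylinder X w].

(* In the two limits below the term at n = 0 is 0, since 0^-1 = 0. *)
Definition htop (R : realType) (A : finType) (X : subshift A) : R :=
  limn (fun n : nat => n%:R^-1 * ln (#|lang X n|%:R : R)).

Definition shift_invariant (R : realType) (A : finType) (X : subshift A)
    (mu : probability (borel X) R) : Prop :=
  forall (n : int) (B : set (borel X)), measurable B ->
    mu (@subshift_map A X n @^-1` B) = mu B.

Definition word_measure (R : realType) (A : finType) (X : subshift A)
    (mu : probability (borel X) R) (n : nat) (w : n.-tuple A) : R :=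
  fine (mu (cylinder X w)).

(* ln 0 = 0, so words of measure 0 contribute 0. *)
Definition entropy (R : realType) (A : finType) (X : subshift A)
    (mu : probability (borel X) R) : R :=
  limn (fun n : nat => n%:R^-1 *
    \sum_(w : n.-tuple A) - word_measure mu w * ln (word_measure mu w)).

Definition is_mme (R : realType) (A : finType) (X : subshift A)
    (mu : probability (borel X) R) : Prop :=
  shift_invariant mu /\ entropy mu = htop R X.

(* Main.v *)
Require Import Defs.
From HB Require Import structures.
From mathcomp Require Import all_boot all_order all_algebra.
From mathcomp Require Import all_classical all_reals all_analysis.
From mathcomp Require Import zify ring lra.

Set Implicit Arguments.
Unset Strict Implicit.
Unset Printing Implicit Defensive.

Import Order.TTheory GRing.Theory Num.Theory.
Import numFieldNormedType.Exports.

Local Open Scope classical_set_scope.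
Local Open Scope ring_scope.

(** Write h for the common value of the entropy of mu and of X, m = |v| and
    n = |w|.  By symmetry the inequality mu(v) e^(h (m - n)) <= mu(w) is enough,
    and it already follows from the inclusion E(v) `<=` E(w), which says that
    any occurrence of v in a word of the language may be replaced by w.

    Consider all pairs (u, S), where u is a word of length N in the language and
    S is a set of disjoint occurrences of v in u.  Replacing the members of S by
    w gives a word u' of the language, and (u, S) can be recovered from u'
    together with the set of positions of the new copies of w, which is a subset
    of the set of all occurrences of w in u'.  If each pair has weight t^|S|,
    the pairs over u weigh at least (1 + t')^(occ v u) with t' close to t, while
    the subsets of the occurrences of w in u', with weight s for each member,
    weigh at most (1 + s)^(occ w u').  Each replacement changes the length by
    n - m, hence the number of available words u' by a factor e^(h (n - m)), and
    creates a bounded number of occurrences of w.  With t chosen accordingly,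
    close to s e^(h (m - n)), the sum over u of (1 + t')^(occ v u) /
    (1 + s)^(occ w u) is at most e^((h + o(1)) N) ([replacement_count]).

    The Gibbs inequality ([gibbs_variational]) converts this bound on a weighted
    number of words into one on averages under mu: the entropy H_N of the words
    of length N satisfies
      H_N + ln(1 + t') E[occ v] - ln(1 + s) E[occ w] <= (h + o(1)) N.
    Because mu has maximal entropy, H_N >= h N by subadditivity ([fekete]), and
    by stationarity the expectations are N mu(v) and N mu(w) up to bounded terms
    ([expected_occ]).  So ln(1 + t') mu(v) <= ln(1 + s) mu(w) + o(1), and the
    claim follows on dividing by s and letting s tend to 0. *)

(** * Words, occurrences and marked words *)

Section Occurrences.
Local Open Scope nat_scope.
Variable A : eqType.
Implicit Types (a b u v w : seq A) (p : seq (option A)).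

Fixpoint occ w u : nat :=
  if u is _ :: u' then prefix w u + occ w u' else 0.

Lemma occ_cons w x u : occ w (x :: u) = prefix w (x :: u) + occ w u.
Proof. by []. Qed.

Lemma occ_le_size w u : occ w u <= size u.
Proof. by elim: u => // x u IH; rewrite occ_cons (leq_add (leq_b1 _) IH). Qed.

Lemma occ_cat_ge w a b : occ w a + occ w b <= occ w (a ++ b).
Proof.
elim: a => // x a IH; rewrite cat_cons !occ_cons -addnA leq_add //.
case E: (prefix w (x :: a)) => //.
by rewrite -cat_cons (prefix_catl b E).
Qed.

(** Only an occurrence starting among the last |w| - 1 letters of a can straddle
    the two factors. *)
Lemma occ_cat_le w a b : occ w (a ++ b) <= occ w a + occ w b + size w.
Proof.
suff: occ w (a ++ b) <= occ w a + occ w b + minn (size a) (size w).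
  by move/leq_trans; apply; rewrite leq_add2l geq_minr.
elim: a => [|x a IH]; first by rewrite min0n addn0.
rewrite cat_cons !occ_cons.
have [lt_aw|le_wa] := ltnP (size a) (size w).
  rewrite (minn_idPl lt_aw) (minn_idPl (ltnW lt_aw)) in IH *.
  rewrite addnS -addn1 addnC leq_add ?leq_b1//.
  by rewrite (leq_trans IH)// leq_add2r leq_add2r leq_addl.
have -> : prefix w (x :: a ++ b) = prefix w (x :: a).
  by rewrite !prefixE -cat_cons takel_cat //= leqW.
rewrite (minn_idPr le_wa) in IH; rewrite (minn_idPr (leqW le_wa)).
by rewrite -!addnA leq_add2l !addnA.
Qed.

(** A sequence p with letters in [option A] stands for a word with a chosen set
    of disjoint occurrences of v, namely [fill v p] with the occurrences coming
    from the entries [None].  Replacing these by w is then [fill w p], and the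
    pair of w and p determines everything, so that no positions need to be
    handled. *)
Definition fill v p : seq A :=
  flatten [seq if o is Some x then [:: x] else v | o <- p].

Definition marks p : nat := count_mem None p.

Lemma fill_cons v o p :
  fill v (o :: p) = (if o is Some x then [:: x] else v) ++ fill v p.
Proof. by []. Qed.

Lemma size_fill v p :
  size (fill v p) = (size p - marks p) + marks p * size v.
Proof.
rewrite /marks; elim: p => //= o p IH; rewrite fill_cons size_cat IH.
have le := count_size (pred1 None) p.
case: o => [x|] /=; first by rewrite !add0n subSn.
by rewrite add1n subSS mulSn addnCA.
Qed.

Lemma size_fill_ge v p : 0 < size v -> size p <= size (fill v p).
Proof.
move=> v_gt0; rewrite size_fill -[X in X <= _](subnK (count_size (pred1 None) p)).
by rewrite leq_add2l leq_pmulr.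
Qed.

Lemma size_fill_le v p : 0 < size v -> size (fill v p) <= size p * size v.
Proof.
move=> v_gt0; rewrite size_fill -[X in _ <= X * _](subnK (count_size (pred1 None) p)).
by rewrite mulnDl leq_add2r leq_pmulr.
Qed.

(** Each inserted copy of w, together with its two borders, accounts for at most
    3 |w| occurrences; all others lie in a stretch of unmarked letters and are
    also present in [fill v p]. *)
Lemma occ_fill v w p :
  occ w (fill w p) <= occ w (fill v p) + 3 * size w * marks p.
Proof.
(* The word q collects the unmarked letters since the last mark. *)
suff H q : occ w (q ++ fill w p) <=
    occ w (q ++ fill v p) + 3 * size w * marks p by exact: (H [::]).
rewrite /marks; elim: p q => [|[x|] p IH] q; first by rewrite muln0 addn0.
  by rewrite !fill_cons -!cat_rcons; exact: IH.
rewrite !fill_cons /= add1n mulnS addnA.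
have h1 := occ_cat_le w q (w ++ fill w p).
have h2 := occ_cat_le w w (fill w p).
have h3 := occ_le_size w w.
have h4 := IH [::].
have h5 := occ_cat_ge w q (v ++ fill v p).
have h6 := occ_cat_ge w v (fill v p).
move: (3 * size w * _) h4 => M /= h4; lia.
Qed.

(** All p with [fill v p = u] (see [parsesP]).  The counter j is the number of
    letters still covered by a copy of v whose mark has been emitted; it makes
    the recursion structural. *)
Fixpoint parses v (j : nat) u : seq (seq (option A)) :=
  match u, j with
  | [::], _ => [:: [::]]
  | _ :: u', j'.+1 => parses v j' u'
  | x :: u', 0 =>
      map (cons (Some x)) (parses v 0 u') ++
      (if prefix v u then map (cons None) (parses v (size v).-1 u') else [::])
  end.

Lemma parses_cons v x u : parses v 0 (x :: u) =
  map (cons (Some x)) (parses v 0 u) ++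
  if prefix v (x :: u) then map (cons None) (parses v (size v).-1 u) else [::].
Proof. by []. Qed.

Lemma parses_drop v j u : parses v j u = parses v 0 (drop j u).
Proof. by elim: u j => [|x u IH] [|j]; rewrite ?drop0 //=. Qed.

Lemma parsesP v u p : 0 < size v -> (p \in parses v 0 u) = (fill v p == u).
Proof.
move=> v_gt0; elim: {u}(size u) {-2}u (leqnn (size u)) p => [|k IH] [|x u] // .
- move=> _ p; rewrite inE; case: p => // o p; rewrite fill_cons.
  by case: o => //; rewrite -size_eq0 size_cat; move: v_gt0; case: (size v).
- move=> _ p; rewrite inE; case: p => // o p; rewrite fill_cons.
  by case: o => //; rewrite -size_eq0 size_cat; move: v_gt0; case: (size v).
rewrite [size _]/= ltnS => uk p; rewrite parses_cons mem_cat; apply/orP/eqP.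
- case=> [/mapP[q]|].
    by rewrite IH// => /eqP <- ->.
  case: ifP => // /prefixP[b ub] /mapP[q].
  rewrite parses_drop IH; last by rewrite size_drop (leq_trans (leq_subr _ _)).
  move=> /eqP qE ->; rewrite fill_cons qE ub; congr (_ ++ _).
  by move: ub; case: (v) v_gt0 => // y v' _ [_ ->] /=; rewrite drop_size_cat.
- case: p => // -[y|] p; rewrite fill_cons.
    move=> [-> pu]; left; rewrite mem_map; last by move=> ? ? [].
    by rewrite IH// pu.
  move=> pu; right; rewrite -pu prefix_prefix mem_map; last by move=> ? ? [].
  rewrite parses_drop IH; last by rewrite size_drop (leq_trans (leq_subr _ _)).
  by move: pu; case: (v) v_gt0 => // z v' _ [_ <-] /=; rewrite drop_size_cat.
Qed.

Lemma parses_uniq v j u : uniq (parses v j u).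
Proof.
elim: u j => [|x u IH] [|j] //=; rewrite -/(parses v 0 (x :: u)) parses_cons.
rewrite cat_uniq map_inj_uniq; last by move=> ? ? [].
rewrite IH /=; case: ifP => // _.
rewrite map_inj_uniq ?IH ?andbT; last by move=> ? ? [].
by apply/hasPn => _ /mapP[q _ ->]; apply/negP => /mapP[].
Qed.

End Occurrences.

Section Words.
Local Open Scope nat_scope.
Variable A : finType.

Definition words N : seq (seq A) := [seq val u | u <- enum {: N.-tuple A}].

Lemma mem_words N u : (u \in words N) = (size u == N).
Proof.
apply/mapP/eqP => [[t _ ->]|uN]; first exact: size_tuple.
by rewrite -uN; exists (in_tuple u); rewrite ?mem_enum.
Qed.

Lemma words_uniq N : uniq (words N).
Proof. by rewrite map_inj_uniq ?enum_uniq//; exact: val_inj. Qed.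

Lemma words_cat m n :
  perm_eq (words (m + n)) [seq a ++ b | a <- words m, b <- words n].
Proof.
apply: uniq_perm; first exact: words_uniq.
  apply: allpairs_uniq; [exact: words_uniq|exact: words_uniq|].
  move=> [a b] [a' b'] /allpairsP[[x y]/= [+ _ [-> _]]].
  rewrite mem_words => /eqP xm /allpairsP[[x' y']/= [+ _ [-> _]]].
  rewrite mem_words => /eqP xm' /eqP; rewrite eqseq_cat ?xm ?xm'//.
  by case/andP=> /eqP -> /eqP ->.
move=> u; rewrite mem_words; apply/eqP/allpairsP.
- move=> uE; exists (take m u, drop m u) => /=; rewrite !mem_words cat_take_drop.
  by rewrite size_drop uE size_takel ?uE ?leq_addr// addKn !eqxx.
- by move=> [[a b]/= []]; rewrite !mem_words => /eqP <- /eqP <- ->; rewrite size_cat.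
Qed.

Lemma words_cons n :
  perm_eq (words n.+1) [seq x :: u | x <- enum A, u <- words n].
Proof.
apply: uniq_perm; first exact: words_uniq.
  apply: allpairs_uniq; [exact: enum_uniq|exact: words_uniq|].
  by move=> [a b] [a' b'] _ _ [-> ->].
move=> u; rewrite mem_words; apply/eqP/allpairsP.
- case: u => // x u [uE]; exists (x, u) => /=.
  by rewrite mem_enum mem_words uE.
- by move=> [[a b]/= [_]]; rewrite mem_words => /eqP <- ->.
Qed.

End Words.

(** * Counting words with weighted sets of replacements *)

Lemma ler_sum_sub (R : numDomainType) (T : eqType) (P Q : seq T) (F : T -> R) :
  uniq P -> {subset P <= Q} -> (forall x, 0 <= F x) ->
  \sum_(x <- P) F x <= \sum_(x <- Q) F x.
Proof.
move=> + + F0; elim: P Q => [|x P IH] Q /=.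
  by move=> _ _; rewrite big_nil sumr_ge0.
move=> /andP[xP uP] PQ; have xQ : x \in Q by apply: PQ; rewrite inE eqxx.
rewrite (perm_big _ (perm_to_rem xQ)) !big_cons lerD2l; apply: IH => // y yP.
have := PQ y; rewrite inE yP orbT => /(_ isT).
by rewrite (perm_mem (perm_to_rem xQ)) inE => /orP[/eqP yx|//]; rewrite -yx yP in xP.
Qed.

Lemma uniq_flatten_map (S T : eqType) (f : S -> seq T) (s : seq S) :
  uniq s -> (forall x, uniq (f x)) ->
  (forall x y z, z \in f x -> z \in f y -> x = y) ->
  uniq (flatten (map f s)).
Proof.
move=> + uf inj; elim: s => //= x s IH /andP[xs us].
rewrite cat_uniq uf IH// andbT /=; apply/hasPn => z /flatten_mapP[y ys zy].
by apply: contraNN xs => zx; rewrite (inj _ _ _ zx zy).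
Qed.

Section Weights.
Variables (R : realFieldType) (A : finType).
Implicit Types (u v w : seq A) (p : seq (option A)) (t : R).

(** The partition function of sets of disjoint occurrences of v in u, each
    occurrence having activity t. *)
Definition parse_weight v t u : R := \sum_(p <- parses v 0 u) t ^+ marks p.

Lemma parse_weight_nil v t : parse_weight v t [::] = 1.
Proof. by rewrite /parse_weight big_seq1 expr0. Qed.

Lemma parse_weight_cons v t x u : parse_weight v t (x :: u) =
  parse_weight v t u +
  (prefix v (x :: u))%:R * (t * parse_weight v t (drop (size v).-1 u)).
Proof.
rewrite /parse_weight parses_cons big_cat big_map /=; congr (_ + _).
case: ifP => _; last by rewrite big_nil mul0r.
rewrite mul1r big_map parses_drop mulr_sumr; apply: eq_bigr => p _.
by rewrite -exprS.
Qed.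

Lemma parse_weight_ge0 v t u : 0 <= t -> 0 <= parse_weight v t u.
Proof. by move=> t0; apply: sumr_ge0 => p _; rewrite exprn_ge0. Qed.

Lemma parse_weight_drop_le v t u k : 0 <= t ->
  parse_weight v t (drop k u) <= parse_weight v t u.
Proof.
move=> t0; elim: u k => [|x u IH] [|k] //.
rewrite [drop _ _]/= (le_trans (IH k))// parse_weight_cons lerDl.
by rewrite !mulr_ge0// parse_weight_ge0.
Qed.

Lemma parse_weight_le_drop v t u k : 0 <= t ->
  parse_weight v t u <= (1 + t) ^+ k * parse_weight v t (drop k u).
Proof.
move=> t0; have t1 : 0 <= 1 + t by rewrite addr_ge0.
elim: u k => [|x u IH] [|k]; rewrite ?drop0 ?mul1r//.
  by rewrite ler_peMl ?parse_weight_ge0// exprn_ege1// lerDl.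
rewrite [drop _ _]/= exprS -mulrA (@le_trans _ _ ((1 + t) * parse_weight v t u))//.
  rewrite parse_weight_cons mulrDl mul1r lerD2l.
  case: prefix; last by rewrite mul0r mulr_ge0// parse_weight_ge0.
  by rewrite mul1r ler_wpM2l// parse_weight_drop_le.
by rewrite ler_wpM2l.
Qed.

Lemma parse_weight_le v t u : 0 <= t ->
  parse_weight v t u <= (1 + t) ^+ occ v u.
Proof.
move=> t0; have t1 : 0 <= 1 + t by rewrite addr_ge0.
elim: u => [|x u IH]; first by rewrite parse_weight_nil.
rewrite parse_weight_cons occ_cons exprD.
case: prefix; last by rewrite mul0r addr0 mul1r.
rewrite mul1r expr1 (le_trans _ (ler_wpM2l t1 IH))// mulrDl mul1r lerD2l.
by rewrite ler_wpM2l// parse_weight_drop_le.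
Qed.

(** Disjointness costs little: choosing an occurrence of v forbids at most the
    |v| - 1 occurrences that start inside it, and dropping these letters divides
    the weight by at most (1 + t)^(|v| - 1).  So every occurrence contributes a
    factor 1 + t (1 + O(t)). *)
Lemma parse_weight_ge v t u : 0 <= t ->
  (1 + t / (1 + t) ^+ size v) ^+ occ v u <= parse_weight v t u.
Proof.
move=> t0; have t1 : 0 < 1 + t by rewrite ltr_pwDl.
have tk k : 0 < (1 + t) ^+ k by rewrite exprn_gt0.
have t2 : 0 <= 1 + t / (1 + t) ^+ size v by rewrite addr_ge0// divr_ge0// ltW.
elim: u => [|x u IH]; first by rewrite parse_weight_nil.
rewrite parse_weight_cons occ_cons exprD.
case: prefix; last by rewrite mul0r addr0 mul1r.
rewrite mul1r expr1 (le_trans (ler_wpM2l t2 IH))// mulrDl mul1r lerD2l.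
rewrite mulrAC -mulrA ler_wpM2l// ler_pdivrMr//.
rewrite (le_trans (parse_weight_le_drop v u (size v).-1 t0))// mulrC.
by rewrite ler_wpM2l ?parse_weight_ge0// ler_weXn2l ?lerDl// leq_pred.
Qed.

(** The replacement map sends the marked words p with [fill v p] of length N
    injectively to the marked words over the images [fill w p].  In the value of
    t, the quotient of powers of q pays for the change of length, words of
    length l being weighted by q^-l, and the power of 1 + s pays for the new
    occurrences of w.  With L the language and q slightly larger than the
    exponential of its entropy, the right-hand side is q^N up to a factor linear
    in N. *)
Lemma replacement_count v w (L : pred (seq A)) (s q t : R) N :
  (0 < size v)%N -> (0 < size w)%N ->
  (forall p, L (fill v p) -> L (fill w p)) ->
  0 <= s -> 0 < q ->
  t = s * q ^+ size v / (q ^+ size w * (1 + s) ^+ (3 * size w)) ->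
  \sum_(u <- words A N | L u) parse_weight v t u / (1 + s) ^+ occ w u <=
  \sum_(0 <= l < (N * size w).+1) \sum_(u <- words A l | L u) q ^+ N / q ^+ l.
Proof.
move=> v0 w0 HL s0 q0 tE.
have s1 : 0 < 1 + s by rewrite ltr_pwDl.
have q1 k : 0 < q ^+ k by rewrite exprn_gt0.
have s1k k : 0 < (1 + s) ^+ k by rewrite exprn_gt0.
(* The weight of p seen from the image word. *)
pose F p : R := s ^+ marks p * (q ^+ N / q ^+ size (fill w p))
  / (1 + s) ^+ occ w (fill w p).
have F0 p : 0 <= F p.
  by rewrite /F !mulr_ge0 ?invr_ge0 ?exprn_ge0// ltW.
have stepF p : size (fill v p) = N ->
    t ^+ marks p / (1 + s) ^+ occ w (fill v p) <= F p.
  move=> pN; rewrite /F -pN !size_fill tE.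
  set k := marks p; set j := (size p - k)%N.
  have hle : (1 + s) ^+ occ w (fill w p) <=
      (1 + s) ^+ occ w (fill v p) * (1 + s) ^+ (3 * size w * k).
    by rewrite -exprD ler_weXn2l ?lerDl// occ_fill.
  have -> : (s * q ^+ size v / (q ^+ size w * (1 + s) ^+ (3 * size w))) ^+ k =
      s ^+ k * q ^+ (k * size v) /
        (q ^+ (k * size w) * (1 + s) ^+ (3 * size w * k)).
    by rewrite expr_div_n !exprMn -!exprM [(size v * k)%N]mulnC [(size w * k)%N]mulnC.
  set S3 := (1 + s) ^+ (3 * _ * _) in hle *.
  rewrite !exprD.
  set qv := q ^+ _; set qw := q ^+ (k * _).
  have -> : q ^+ j * qv / (q ^+ j * qw) = qv / qw.
    by rewrite -mulf_div divff ?mul1r ?gt_eqF.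
  rewrite -[X in X <= _]mulrA invfM -!mulrA ler_wpM2l ?exprn_ge0//.
  rewrite (ler_wpM2l (ltW (q1 _)))// ler_wpM2l ?invr_ge0 ?(ltW (q1 _))//.
  have S30 : 0 < S3 by exact: s1k.
  by rewrite -invfM lef_pV2 ?posrE ?mulr_gt0// mulrC.
(* P lists the marked words before, Q those after the replacement. *)
pose P := flatten [seq parses v 0 u | u <- words A N & L u].
pose Q := flatten [seq flatten [seq parses w 0 u | u <- words A l & L u] |
                    l <- iota 0 (N * size w).+1].
have uP : uniq P.
  apply: uniq_flatten_map; first by rewrite filter_uniq// words_uniq.
    by move=> u; exact: parses_uniq.
  by move=> x y z; rewrite !parsesP// => /eqP -> /eqP.
have PQ : {subset P <= Q}.
  move=> p /flatten_mapP[u]; rewrite mem_filter mem_words => /andP[Lu /eqP uN].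
  rewrite parsesP// => /eqP pu.
  apply/flatten_mapP; exists (size (fill w p)).
    rewrite mem_iota add0n leq0n ltnS -uN -pu /=.
    by rewrite (leq_trans (size_fill_le _ w0))// leq_mul2r size_fill_ge ?orbT.
  apply/flatten_mapP; exists (fill w p); last by rewrite parsesP.
  by rewrite mem_filter mem_words eqxx andbT HL// pu.
apply: (@le_trans _ _ (\sum_(p <- P) F p)).
  rewrite /P big_flatten big_map big_filter big_seq_cond [X in _ <= X]big_seq_cond.
  apply: ler_sum => u; rewrite mem_words => /andP[/eqP uN Lu].
  rewrite /parse_weight mulr_suml big_seq [X in _ <= X]big_seq.
  apply: ler_sum => p; rewrite parsesP// => /eqP pu.
  by rewrite -pu; apply: stepF; rewrite pu.
apply: (le_trans (ler_sum_sub uP PQ F0)).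
rewrite /Q big_flatten big_map /index_iota subn0; apply: ler_sum => l _.
rewrite big_flatten big_map big_filter big_seq_cond [X in _ <= X]big_seq_cond.
apply: ler_sum => u; rewrite mem_words => /andP[/eqP ul Lu].
have -> : \sum_(p <- parses w 0 u) F p =
    q ^+ N / q ^+ l * (parse_weight w s u / (1 + s) ^+ occ w u).
  rewrite /parse_weight mulr_suml mulr_sumr big_seq [RHS]big_seq.
  apply: eq_bigr => p; rewrite parsesP// => /eqP pu.
  by rewrite /F pu ul -[LHS]mulrA mulrCA.
rewrite ler_piMr ?(divr_ge0 (ltW (q1 _)) (ltW (q1 _)))//.
by rewrite ler_pdivrMr// mul1r parse_weight_le.
Qed.

End Weights.

(** * Gibbs inequality, subadditive sequences, stationary word distributions *)

Section Gibbs.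
Variables (R : realType) (T : eqType).
Implicit Types (p q g : T -> R) (r : seq T).

Lemma gibbs r p q : (forall x, 0 <= p x) -> (forall x, 0 <= q x) ->
  (forall x, 0 < p x -> 0 < q x) ->
  \sum_(x <- r) q x <= \sum_(x <- r) p x ->
  \sum_(x <- r) - p x * ln (p x) <= \sum_(x <- r) - p x * ln (q x).
Proof.
move=> p0 q0 pq leqp; rewrite -subr_le0 -sumrB.
apply: (@le_trans _ _ (\sum_(x <- r) (q x - p x))); last by rewrite sumrB subr_le0.
apply: ler_sum => x _.
have := p0 x; rewrite le_eqVlt => /predU1P[<-|px].
  by rewrite oppr0 !mul0r subr0 addr0 q0.
have qx := pq _ px.
rewrite -mulrBr mulNr -mulrN opprB -ln_div//.
have := @le_ln1Dx R (q x / p x - 1); rewrite [1 + _]addrC subrK.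
rewrite ltrBrDl addrN divr_gt0// => /(_ isT) h.
rewrite (le_trans (ler_wpM2l (ltW px) h))// mulrBr mulr1 mulrCA.
by rewrite divff ?gt_eqF// mulr1.
Qed.

(** Among all distributions, entropy plus expected [ln g] is maximal for the one
    proportional to g, where it is the logarithm of the total weight.  This turns
    upper bounds for weighted counts into bounds for expectations. *)
Lemma gibbs_variational r (L : pred T) p g M : (forall x, 0 <= p x) ->
  \sum_(x <- r) p x = 1 -> (forall x, 0 < p x -> L x) -> (forall x, 0 < g x) ->
  \sum_(x <- r | L x) g x <= M ->
  \sum_(x <- r) - p x * ln (p x) + \sum_(x <- r) p x * ln (g x) <= ln M.
Proof.
move=> p0 p1 pL g0; set Z := \sum_(x <- r | L x) g x => ZM.
have Z0 : 0 < Z.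
  rewrite lt_neqAle sumr_ge0; last by move=> x _; rewrite ltW.
  rewrite andbT eq_sym; apply/eqP => Z0.
  have : \sum_(x <- r) p x = 0.
    rewrite big_seq; apply: big1 => x xr; apply/eqP; rewrite eq_le p0 andbT leNgt.
    apply/negP => /pL Lx; move: Z0; rewrite /Z (perm_big _ (perm_to_rem xr)).
    rewrite big_cons Lx => /eqP; rewrite gt_eqF// ltr_pwDl//.
    by apply: sumr_ge0 => y _; rewrite ltW.
  by rewrite p1 => /eqP; rewrite oner_eq0.
apply: (@le_trans _ _ (ln Z)); last first.
  by rewrite ler_ln ?posrE// (lt_le_trans Z0).
pose q x := if L x then g x / Z else 0.
have H : \sum_(x <- r) - p x * ln (p x) <= \sum_(x <- r) - p x * ln (q x).
  apply: gibbs => // [x|x /pL Lx|]; rewrite /q.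
  - by case: ifP => // _; rewrite divr_ge0 ?ltW.
  - by rewrite Lx divr_gt0.
  - by rewrite p1 -big_mkcond -mulr_suml divff ?gt_eqF.
rewrite -lerBrDr (le_trans H)// lerBrDr -big_split /=.
have -> : ln Z = \sum_(x <- r) p x * ln Z by rewrite -mulr_suml p1 mul1r.
apply: ler_sum => x _; have := p0 x; rewrite le_eqVlt => /predU1P[<-|px].
  by rewrite oppr0 !mul0r addr0.
by rewrite /q (pL _ px) ln_div ?posrE//; lra.
Qed.

End Gibbs.

Section Fekete.
Variable R : realType.
Implicit Type u : nat -> R.

Lemma subadditive_bound u k n : (0 < k)%N -> (forall i, 0 <= u i) ->
  (forall i j, u (i + j)%N <= u i + u j) ->
  u n <= u k / k%:R * n%:R + \sum_(i < k) u i.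
Proof.
move=> k0 u0 uD; have k0' : 0 < k%:R :> R by rewrite ltr0n.
have uM q r : u (q * k + r)%N <= q%:R * u k + u r.
  elim: q => [|q IH]; first by rewrite mul0r add0r.
  by rewrite mulSn -addnA (le_trans (uD _ _))// -natr1 mulrDl mul1r; lra.
rewrite [in X in X <= _](divn_eq n k) (le_trans (uM _ _))// lerD//.
  rewrite mulrC -mulrA ler_wpM2l// mulrC ler_pdivlMr// -natrM ler_nat.
  exact: leq_divM.
have nk : (n %% k < k)%N by rewrite ltn_mod.
rewrite (bigD1 (Ordinal nk))//= lerDl; exact: sumr_ge0.
Qed.

(** Fekete's lemma.  The limit is the infimum of the quotients, which is the
    first conclusion; the second is the resulting upper bound, uniform in n. *)
Lemma fekete u : (forall i, 0 <= u i) ->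
  (forall i j, u (i + j)%N <= u i + u j) ->
  let l := limn (fun n : nat => n%:R^-1 * u n) in
  (forall n, l * n%:R <= u n) /\
  (forall e, 0 < e -> exists B, forall n, u n <= (l + e) * n%:R + B).
Proof.
move=> u0 uD; pose S := [set u n / n%:R | n in [set n : nat | (0 < n)%N]].
pose l := inf S.
have lbS : lbound S 0 by move=> _ [n _ <-]; rewrite divr_ge0.
have hS : has_inf S.
  split; first by exists (u 1%N / 1); exists 1%N.
  by exists 0.
have l1 n : l * n%:R <= u n.
  case: n => [|n]; first by rewrite mulr0.
  rewrite -ler_pdivlMr ?ltr0n//; apply: ge_inf; first by exists 0.
  by exists n.+1.
have l2 e : 0 < e -> exists2 B, 0 <= B & forall n, u n <= (l + e) * n%:R + B.
  move=> e0; have [_ [k /= k0 <-] kl] := inf_adherent e0 hS.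
  exists (\sum_(i < k) u i); first exact: sumr_ge0.
  move=> n; rewrite (le_trans (subadditive_bound n k0 u0 uD))//.
  by rewrite lerD2r ler_wpM2r// ltW.
suff -> : limn (fun n : nat => n%:R^-1 * u n) = l.
  split => // e /l2[B _ HB]; by exists B.
apply/cvg_lim => //; apply/cvgrPdist_le => /= e e0.
have e20 : 0 < e / 2 by rewrite divr_gt0.
have [B B0 HB] := l2 _ e20.
near=> n; have n0 : 0 < n%:R :> R.
  by rewrite ltr0n; near: n; exact: nbhs_infty_gt.
have nB : B <= (e / 2) * n%:R.
  rewrite -ler_pdivrMl//; near: n; exact: nbhs_infty_ger.
rewrite distrC ler_norml; apply/andP; split.
  by rewrite lerBrDr mulrC ler_pdivlMr// (le_trans _ (l1 n))// ler_wpM2r//; lra.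
rewrite lerBlDr mulrC ler_pdivrMr// (le_trans (HB n))//.
by move: nB; set x := n%:R => nB; nra.
Unshelve. all: by end_near. Qed.

End Fekete.

(** The word probabilities P of a stationary process: a probability on the
    words of each length, consistent under deletion of the first letter as well
    as of the last one. *)
Section StationaryWords.
Variables (R : realType) (A : finType) (P : seq A -> R).
Hypothesis P_ge0 : forall u, 0 <= P u.
Hypothesis P_nil : P [::] = 1.
Hypothesis P_consE : forall u, \sum_(x : A) P (x :: u) = P u.
Hypothesis P_rconsE : forall u, \sum_(x : A) P (rcons u x) = P u.
Implicit Types u v w : seq A.

Lemma sum_words_cons (F : seq A -> R) n :
  \sum_(u <- words A n.+1) F u = \sum_(x : A) \sum_(u <- words A n) F (x :: u).
Proof. by rewrite (perm_big _ (words_cons A n)) big_allpairs_dep big_enum. Qed.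

Lemma sum_words_cat (F : seq A -> R) m n :
  \sum_(u <- words A (m + n)) F u =
  \sum_(a <- words A m) \sum_(b <- words A n) F (a ++ b).
Proof. by rewrite (perm_big _ (words_cat A m n)) big_allpairs_dep. Qed.

Lemma words0 : words A 0 = [:: [::]].
Proof.
apply: perm_small_eq => //; apply: uniq_perm; rewrite ?words_uniq// => u.
by rewrite mem_words inE size_eq0.
Qed.

Lemma marginal_prefix k u : \sum_(a <- words A k) P (a ++ u) = P u.
Proof.
elim: k => [|k IH]; first by rewrite words0 big_seq1.
rewrite sum_words_cons exchange_big /= -[RHS]IH; apply: eq_bigr => a _.
exact: P_consE.
Qed.

Lemma marginal_suffix k u : \sum_(b <- words A k) P (u ++ b) = P u.
Proof.
elim: k u => [|k IH] u; first by rewrite words0 big_seq1 cats0.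
rewrite sum_words_cons -[RHS]P_rconsE; apply: eq_bigr => x _.
by rewrite -IH; apply: eq_bigr => b _; rewrite cat_rcons.
Qed.

Lemma sum_words1 n : \sum_(u <- words A n) P u = 1.
Proof. by rewrite -P_nil -(marginal_suffix n). Qed.

Definition block_entropy n : R := \sum_(u <- words A n) - P u * ln (P u).

Lemma P_le1 u : P u <= 1.
Proof.
rewrite -(sum_words1 (size u)).
have uw : u \in words A (size u) by rewrite mem_words.
by rewrite (perm_big _ (perm_to_rem uw)) big_cons lerDl sumr_ge0.
Qed.

Lemma block_entropy_ge0 n : 0 <= block_entropy n.
Proof.
by apply: sumr_ge0 => u _; rewrite mulNr oppr_ge0 mulr_ge0_le0// ln_le0// P_le1.
Qed.

(** The Gibbs inequality against the product of the two marginals. *)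
Lemma block_entropyD m n :
  block_entropy (m + n) <= block_entropy m + block_entropy n.
Proof.
pose q u := P (take m u) * P (drop m u).
have q_cat a b : a \in words A m -> q (a ++ b) = P a * P b.
  by rewrite mem_words => /eqP am; rewrite /q take_size_cat// drop_size_cat.
have P_take u : P u <= P (take m u).
  rewrite -{1}(cat_take_drop m u) -(marginal_suffix (size (drop m u)) (take m u)).
  have uw : drop m u \in words A (size (drop m u)) by rewrite mem_words.
  by rewrite (perm_big _ (perm_to_rem uw)) big_cons lerDl sumr_ge0.
have P_drop u : P u <= P (drop m u).
  rewrite -{1}(cat_take_drop m u) -(marginal_prefix (size (take m u)) (drop m u)).
  have uw : take m u \in words A (size (take m u)) by rewrite mem_words.
  by rewrite (perm_big _ (perm_to_rem uw)) big_cons lerDl sumr_ge0.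
have q_ge0 u : 0 <= q u by rewrite mulr_ge0.
have q_gt0 u : 0 < P u -> 0 < q u.
  by move=> u0; rewrite mulr_gt0// (lt_le_trans u0) ?P_take ?P_drop.
apply: (le_trans (gibbs P_ge0 q_ge0 q_gt0 _)).
  rewrite sum_words1 sum_words_cat big_seq.
  under eq_bigr => a am do under eq_bigr => b _ do rewrite q_cat//.
  under eq_bigr => a am do rewrite -mulr_sumr sum_words1 mulr1.
  by rewrite -big_seq sum_words1.
rewrite le_eqVlt; apply/orP; left; apply/eqP.
transitivity (\sum_(a <- words A m) \sum_(b <- words A n)
    (- P (a ++ b) * ln (P a) + - P (a ++ b) * ln (P b))).
  rewrite sum_words_cat big_seq [RHS]big_seq; apply: eq_bigr => a am.
  apply: eq_bigr => b _; rewrite q_cat//.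
  have := P_ge0 (a ++ b); rewrite le_eqVlt => /predU1P[<-|ab0].
    by rewrite oppr0 !mul0r addr0.
  rewrite -mulrDr lnM// posrE (lt_le_trans ab0)//.
    by have := P_take (a ++ b); rewrite take_size_cat//; move: am; rewrite mem_words => /eqP.
  by have := P_drop (a ++ b); rewrite drop_size_cat//; move: am; rewrite mem_words => /eqP.
under eq_bigr => a _ do rewrite big_split /= -mulr_suml sumrN marginal_suffix.
rewrite big_split /= exchange_big; congr (_ + _); apply: eq_bigr => b _.
by rewrite -mulr_suml sumrN marginal_prefix.
Qed.

Lemma sum_words_prefix w n : (size w <= n)%N ->
  \sum_(u <- words A n) P u * (prefix w u)%:R = P w.
Proof.
move=> /subnKC <-; rewrite sum_words_cat.
have ww : w \in words A (size w) by rewrite mem_words.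
rewrite (perm_big _ (perm_to_rem ww)) big_cons /= [X in _ + X]big1_seq ?addr0.
  by under eq_bigr => b _ do rewrite prefix_prefix mulr1; exact: marginal_suffix.
move=> a; rewrite (mem_rem_uniq _ (words_uniq _ _)) inE mem_words.
move=> /andP[_ /andP[aw /eqP sa]]; apply: big1 => b _.
by rewrite prefixE -sa take_size_cat// eq_sym in aw *; rewrite (negbTE aw) mulr0.
Qed.

(** By stationarity each of the n + 1 - |w| starting positions at which w fits
    carries it with probability P w. *)
Lemma expected_occ w n : (0 < size w)%N ->
  \sum_(u <- words A n) P u * (occ w u)%:R = (n.+1 - size w)%:R * P w.
Proof.
move=> w0; elim: n => [|n IH].
  by rewrite words0 big_seq1 mulr0 (_ : (1 - size w = 0)%N) ?mul0r//; lia.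
rewrite sum_words_cons.
under eq_bigr => x _ do under eq_bigr => u _ do rewrite occ_cons natrD mulrDr.
under eq_bigr => x _ do rewrite big_split.
rewrite big_split /= -(sum_words_cons (fun u => P u * (prefix w u)%:R)).
rewrite [X in _ + X]exchange_big /=.
under [X in _ + X]eq_bigr => u _ do rewrite -mulr_suml P_consE.
rewrite IH; have [le|lt] := leqP (size w) n.+1.
  by rewrite sum_words_prefix// (subSn le) -natr1 mulrDl mul1r addrC.
rewrite (_ : n.+1 - size w = 0)%N; last lia.
rewrite (_ : n.+2 - size w = 0)%N; last lia.
rewrite mul0r addr0 big1_seq// => u; rewrite mem_words => /andP[_ /eqP un].
rewrite (_ : prefix w u = false) ?mulr0//.
by apply: contraTF lt => /size_prefix; rewrite un -leqNgt.
Qed.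

End StationaryWords.

(** * Languages and word probabilities of subshifts *)

Lemma mkseq_cat (T : Type) (f : nat -> T) m n :
  mkseq f (m + n) = mkseq f m ++ mkseq (fun k => f (m + k)%N) n.
Proof.
by rewrite /mkseq iotaD map_cat add0n -[X in iota X n]addn0 iotaDl -map_comp.
Qed.

Section Language.
Variables (A : finType) (X : subshift A).
Implicit Types (u v w : seq A) (x : fullshift A).

Definition window (i : int) n x : seq A := mkseq (fun k => x (i + Posz k) : A) n.

Lemma size_window i n x : size (window i n x) = n.
Proof. exact: size_mkseq. Qed.

Lemma window_cat i m n x :
  window i (m + n) x = window i m x ++ window (i + Posz m) n x.
Proof.
by rewrite /window mkseq_cat; congr (_ ++ _); apply: eq_mkseq => k; rewrite PoszD addrA.
Qed.

Lemma window_shift i j n x : window i n (shift_map j x) = window (i + j) n x.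
Proof. by apply: eq_mkseq => k; rewrite /shift_map addrAC. Qed.

Lemma prefix_wordE n x : prefix_word n x = window 0 n x :> seq A.
Proof.
rewrite /window /mkseq -val_enum_ord -map_comp /=.
by apply: eq_map => k /=; rewrite add0r.
Qed.

Lemma cylinderP n (w : n.-tuple A) (x : subshift_space X) :
  cylinder X w x <-> window 0 n (set_val x) = w.
Proof. by rewrite -prefix_wordE; split => [->|/val_inj]. Qed.

Lemma set_val_subshift_map j (x : subshift_space X) :
  set_val (subshift_map j x) = shift_map j (set_val x).
Proof. by rewrite set_valE. Qed.

Definition in_lang u : bool :=
  `[< exists2 x, points X x & window 0 (size u) x = u >].

Lemma points_shift j x : points X x -> points X (shift_map j x).
Proof. by move=> Xx; rewrite -(subshift_shift X j); exists x. Qed.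

Lemma in_lang_window x i n : points X x -> in_lang (window i n x).
Proof.
move=> Xx; apply/asboolP; exists (shift_map i x); first exact: points_shift.
by rewrite size_window window_shift add0r.
Qed.

Lemma in_lang_cat u v : in_lang (u ++ v) -> in_lang u && in_lang v.
Proof.
move=> /asboolP[x Xx]; rewrite size_cat window_cat => /eqP.
rewrite eqseq_cat ?size_window// => /andP[/eqP <- /eqP <-].
by rewrite !in_lang_window.
Qed.

Lemma in_lang_tuple n (w : n.-tuple A) : (w \in lang X n) = in_lang w.
Proof.
rewrite inE /in_lang size_tuple; apply: asbool_equiv_eq; split => -[x Xx h]; exists x => //.
  by rewrite -prefix_wordE h.
by apply/val_inj; rewrite /= -h -prefix_wordE.
Qed.

Lemma card_lang n : #|lang X n| = size [seq u <- words A n | in_lang u].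
Proof.
rewrite /words filter_map size_map cardE; congr size.
by rewrite /enum_mem -filter_predI; apply: eq_filter => u /=; rewrite in_lang_tuple andbT.
Qed.

Lemma card_lang_gt0 n : (0 < #|lang X n|)%N.
Proof.
have [x Xx] := subshift_neq0 X.
by apply/card_gt0P; exists (prefix_word n x); rewrite in_lang_tuple prefix_wordE in_lang_window.
Qed.

Lemma card_langD m n : (#|lang X (m + n)| <= #|lang X m| * #|lang X n|)%N.
Proof.
rewrite !card_lang -(size_allpairs cat); apply: uniq_leq_size.
  by rewrite filter_uniq ?words_uniq.
move=> u; rewrite mem_filter (perm_mem (words_cat A m n)).
case/andP => Lu /allpairsP[[a b] /= [am bn uE]].
rewrite uE in Lu *; have /andP[La Lb] := in_lang_cat Lu.
by apply/allpairsP; exists (a, b); rewrite /= !mem_filter am bn La Lb.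
Qed.

(** Shift so that v sits at the origin, excise it, and insert w with the point
    of [w] that the inclusion of extender sets provides. *)
Lemma in_lang_replace m n (v : m.-tuple A) (w : n.-tuple A) a b :
  extender_set X v `<=` extender_set X w ->
  in_lang (a ++ v ++ b) -> in_lang (a ++ w ++ b).
Proof.
move=> Evw /asboolP[x Xx]; rewrite !size_cat !window_cat !add0r size_tuple => /eqP.
rewrite eqseq_cat ?size_window// eqseq_cat ?size_window ?size_tuple//.
move=> /and3P[/eqP xa /eqP xv /eqP xb].
pose i : int := Posz (size a).
pose y : subshift_space X := exist _ (shift_map i x) (mem_set (points_shift i Xx)).
have yE : set_val y = shift_map i x by rewrite set_valE.
have /Evw[z zw zy] : extender_set X v (excise m (set_val y)).
  by exists y => //; apply/cylinderP; rewrite yE window_shift add0r.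
have Xz : points X (set_val z) by exact: set_mem (valP z).
apply/asboolP; exists (shift_map (- i) (set_val z)); first exact: points_shift.
rewrite !size_cat size_tuple !window_cat !window_shift !add0r; congr (_ ++ (_ ++ _)).
- rewrite -{2}xa; apply/eq_in_map => k; rewrite mem_iota add0n => /andP[_ ka].
  have k0 : - i + Posz k < 0 by rewrite /i; lia.
  have := congr1 (fun f => f (- i + Posz k)) zy; rewrite /excise k0 => ->.
  by rewrite yE /shift_map addrAC addNr.
- by rewrite subrr; apply/cylinderP.
- rewrite -{2}xb; apply/eq_mkseq => k.
  have := congr1 (fun f => f (Posz k)) zy.
  rewrite /excise /= yE /shift_map => zyk.
  rewrite (_ : _ - i + Posz k = Posz k + Posz n); last by rewrite /i; lia.
  by rewrite zyk; congr x; rewrite /i; lia.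
Qed.

Lemma in_lang_fill m n (v : m.-tuple A) (w : n.-tuple A) (p : seq (option A)) :
  extender_set X v `<=` extender_set X w ->
  in_lang (fill v p) -> in_lang (fill w p).
Proof.
move=> Evw.
(* The word a is the part in which all marks have been replaced. *)
suff H a : in_lang (a ++ fill v p) -> in_lang (a ++ fill w p).
  exact: (H [::]).
elim: p a => // -[x|] p IH a; rewrite !fill_cons.
  by rewrite -!cat_rcons; exact: IH.
move=> h; rewrite catA; apply: IH; rewrite -catA.
exact: in_lang_replace h.
Qed.

End Language.

Section Measure.
Variables (R : realType) (A : finType) (X : subshift A).
Implicit Types (u v w : seq A).

Lemma cylinder_open n (w : n.-tuple A) : open (cylinder X w).
Proof.
rewrite openE => x xw.
have : \forall y \near x, forall i : 'I_n,
    set_val y (Posz i) = set_val x (Posz i).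
  apply: (@filter_forall _ _ (fun (i : 'I_n) (y : subshift_space X) =>
    set_val y (Posz i) = set_val x (Posz i)) (nbhs x) _) => i.
  have c : continuous (fun y : subshift_space X =>
      set_val y (Posz i) : discrete_topology A).
    move=> y; apply: (@continuous_comp (subshift_space X) (fullshift A)
      (discrete_topology A) set_val (proj (Posz i))); last exact: proj_continuous.
    exact: initial_continuous.
  exact: (c x _ (discrete_set1 (set_val x (Posz i) : discrete_topology A))).
apply: filterS => y yx; rewrite /cylinder /= -xw.
by apply: eq_from_tnth => i; rewrite !tnth_mktuple yx.
Qed.

Lemma cylinder_measurable n (w : n.-tuple A) :
  measurable (cylinder X w : set (borel X)).
Proof. by apply: sub_sigma_algebra; exact: cylinder_open. Qed.

Variables (mu : probability (borel X) R).

(** [word_measure] on untyped words, so that words of different lengths can be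
    concatenated without casts. *)
Definition word_prob u : R := word_measure mu (in_tuple u).

Lemma word_probE n (w : n.-tuple A) : word_prob w = word_measure mu w.
Proof.
rewrite /word_prob /word_measure; congr (fine (mu _)).
by apply/seteqP; split => x /cylinderP h; apply/cylinderP; rewrite -h /= size_tuple.
Qed.

Lemma word_prob_fin u : (word_prob u)%:E = mu (cylinder X (in_tuple u)).
Proof.
by rewrite /word_prob fineK// fin_num_measure//; exact: cylinder_measurable.
Qed.

Lemma word_prob_ge0 u : 0 <= word_prob u.
Proof. by rewrite fine_ge0. Qed.

Lemma word_prob_nil : word_prob [::] = 1.
Proof.
apply/EFin_inj; rewrite word_prob_fin -(probability_setT mu); congr (mu _).
by apply/seteqP; split => // x _; apply/cylinderP.
Qed.

Lemma word_prob_in_lang u : 0 < word_prob u -> in_lang X u.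
Proof.
apply: contraTT => nL; rewrite -leNgt le_eqVlt; apply/orP; left; apply/eqP.
apply/EFin_inj; rewrite word_prob_fin (_ : cylinder X _ = set0) ?measure0//.
apply/seteqP; split => // x /cylinderP h; apply: (negP nL).
by rewrite -[u]h; apply: in_lang_window; exact: set_mem (valP x).
Qed.

Lemma sum_word_prob (f : A -> seq A) :
  trivIset setT (fun a => cylinder X (in_tuple (f a))) ->
  (\sum_(a : A) word_prob (f a))%:E =
  mu (\bigcup_a cylinder X (in_tuple (f a))).
Proof.
move=> tf; rewrite measure_fin_bigcup//; last first.
- by move=> a _; exact: cylinder_measurable.
- exact: finite_finset.
have -> : [set: A] = [set` enum A].
  by apply/seteqP; split => // a _ /=; rewrite mem_enum.
rewrite -fsbig_seq ?enum_uniq// big_enum -sumEFin.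
by apply: eq_bigr => a _; rewrite word_prob_fin.
Qed.

Lemma sum_word_prob_rcons u : \sum_(x : A) word_prob (rcons u x) = word_prob u.
Proof.
apply/EFin_inj; rewrite sum_word_prob.
  rewrite word_prob_fin; congr (mu _); apply/seteqP; split => x.
    move=> [a _ /cylinderP] /=; rewrite size_rcons -addn1 window_cat -cats1 => /eqP.
    rewrite eqseq_cat ?size_window// => /andP[/eqP xu _].
    by apply/cylinderP.
  move=> /cylinderP /= xu; exists (set_val x (Posz (size u))) => //.
  apply/cylinderP; rewrite /= size_rcons -addn1 window_cat xu -cats1.
  by rewrite /window /mkseq /= add0r addr0.
apply/trivIsetP => a b _ _ ab; apply/seteqP; split => // x [/cylinderP] /=.
move=> + /cylinderP /=; rewrite !size_rcons => -> /rcons_inj[] /eqP.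
by rewrite (negbTE ab).
Qed.

Hypothesis mu_inv : shift_invariant mu.

Lemma sum_word_prob_cons u : \sum_(x : A) word_prob (x :: u) = word_prob u.
Proof.
apply/EFin_inj; rewrite sum_word_prob.
  rewrite word_prob_fin -(mu_inv 1 (cylinder_measurable (in_tuple u))).
  congr (mu _); apply/seteqP; split => x.
    move=> [a _ /cylinderP] /=; rewrite -add1n window_cat -cat1s => /eqP.
    rewrite eqseq_cat ?size_window// => /andP[_ /eqP xu].
    by apply/cylinderP; rewrite set_val_subshift_map window_shift.
  move=> /cylinderP /= xu; exists (set_val x 0) => //.
  rewrite set_val_subshift_map window_shift in xu.
  apply/cylinderP; rewrite /= -add1n window_cat -cat1s -{2}xu.
  by rewrite {1}/window /mkseq /= addr0.
apply/trivIsetP => a b _ _ ab; apply/seteqP; split => // x [/cylinderP] /=.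
by move=> + /cylinderP /= => -> [] /eqP; rewrite (negbTE ab).
Qed.

End Measure.

(** * The inequality between word measures *)

Section Limits.
Variable R : realType.

Lemma ln1D_ge (x : R) : 0 <= x -> x / (1 + x) <= ln (1 + x).
Proof.
move=> x0; have x1 : 0 < 1 + x by rewrite ltr_pwDl.
rewrite -lerN2 -lnV ?posrE//.
rewrite [X in ln X](_ : _ = 1 + - (x / (1 + x))); last first.
  by field; rewrite gt_eqF.
apply: le_ln1Dx; rewrite ltrN2 ltr_pdivrMr// mul1r; lra.
Qed.

Lemma linear_bound_le0 (c K : R) : (forall n : nat, c * n%:R <= K) -> c <= 0.
Proof.
move=> H; rewrite leNgt; apply/negP => c0.
have [n _ /(_ _ (leqnn n)) /= h] := nbhs_infty_gtr (K / c).
by have := H n; rewrite leNgt -ltr_pdivrMl// mulrC h.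
Qed.

(** Sublinearity of the logarithm, from 1 + d n <= e^(d n). *)
Lemma ln_linear_le (d : R) k : 0 < d -> exists K, forall n : nat,
  ln ((n * k).+1%:R : R) <= d * n%:R + K.
Proof.
move=> d0; exists (ln (k%:R / d + 1)) => n.
have kd0 : 0 <= k%:R / d by rewrite divr_ge0// ltW.
rewrite -[X in _ <= X + _]expRK -lnM ?posrE ?expR_gt0 ?ltr_wpDl//.
rewrite ler_ln ?posrE ?ltr0n// ?mulr_gt0 ?expR_gt0 ?ltr_wpDl//.
rewrite (@le_trans _ _ ((1 + d * n%:R) * (k%:R / d + 1)))//; last first.
  by rewrite ler_wpM2r ?expR_ge1Dx// addr_ge0.
rewrite -natr1 natrM.
have -> : (1 + d * n%:R) * (k%:R / d + 1) =
    n%:R * k%:R + 1 + (k%:R / d + d * n%:R) by field; rewrite gt_eqF.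
by rewrite lerDl addr_ge0// mulr_ge0// ltW.
Qed.

(** The quotient t / s in [replacement_count] for q = e^(h + s^2): the margin
    above the entropy is tied to s so that a single parameter tends to 0, and it
    is of smaller order than s. *)
Definition exchange_rate (h : R) (m n : nat) (s : R) : R :=
  expR (h + s ^+ 2) ^+ m / (expR (h + s ^+ 2) ^+ n * (1 + s) ^+ (3 * n)).

(** A lower bound for ln(1 + t') / s, where t' is the contribution of an
    occurrence of v in [parse_weight_ge]. *)
Definition relative_gain (h : R) (m n : nat) (s : R) : R :=
  let t := s * exchange_rate h m n s in
  exchange_rate h m n s / (1 + t) ^+ m / (1 + t / (1 + t) ^+ m).

Lemma relative_gain_cvg h m n :
  relative_gain h m n s @[s --> 0^'+] --> expR (h * (m%:R - n%:R)).
Proof.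
have idc : s @[s --> (0:R)] --> (0:R) by exact: cvg_id.
have expc (k : nat) (f : R -> R) (a : R) :
    f s @[s --> (0:R)] --> a -> f s ^+ k @[s --> (0:R)] --> a ^+ k.
  by move=> fa; exact: (cvg_comp _ _ fa (@exprn_continuous R k a)).
have qc : expR (h + s ^+ 2) @[s --> (0:R)] --> expR h.
  have hc : h + s ^+ 2 @[s --> (0:R)] --> h + 0 ^+ 2.
    by apply: cvgD; [exact: cvg_cst|exact: expc].
  rewrite expr0n addr0 in hc.
  exact: (cvg_comp _ _ hc (@continuous_expR R h)).
have onec (f : R -> R) (a : R) : f s @[s --> (0:R)] --> a ->
    1 + f s @[s --> (0:R)] --> 1 + a.
  by move=> fa; apply: cvgD => //; exact: cvg_cst.
have rc : exchange_rate h m n s @[s --> (0:R)] --> expR (h * (m%:R - n%:R)).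
  have -> : expR (h * (m%:R - n%:R)) =
      expR h ^+ m / (expR h ^+ n * (1 + 0) ^+ (3 * n)).
    by rewrite addr0 expr1n mulr1 mulrBr expRD expRN !expRM_natr.
  apply: cvgM; first exact: expc.
  apply: cvgV; first by rewrite addr0 expr1n mulr1 gt_eqF// exprn_gt0 ?expR_gt0.
  by apply: cvgM; apply: expc => //; exact: onec.
have tc : s * exchange_rate h m n s @[s --> (0:R)] --> (0 : R).
  have H := cvgM idc rc; rewrite mul0r in H; exact: H.
have tmc : (1 + s * exchange_rate h m n s) ^+ m @[s --> (0:R)] --> (1 : R).
  have H := expc m _ _ (onec _ _ tc); rewrite addr0 expr1n in H; exact: H.
apply: cvg_at_right_filter.
have -> : expR (h * (m%:R - n%:R)) = expR (h * (m%:R - n%:R)) / 1 / (1 + 0 / 1).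
  by rewrite mul0r addr0 !divr1.
apply: cvgM.
  by apply: cvgM => //; apply: cvgV => //; rewrite oner_eq0.
apply: cvgV; first by rewrite mul0r addr0 oner_eq0.
by apply: onec; apply: cvgM => //; apply: cvgV => //; rewrite oner_eq0.
Qed.

End Limits.

Section Main.
Variables (R : realType) (A : finType) (X : subshift A).

Lemma lang_growth (e : R) : 0 < e -> exists B, forall n,
  ln (#|lang X n|%:R : R) <= (htop R X + e) * n%:R + B.
Proof.
pose u n := ln (#|lang X n|%:R : R); move: e; have [] // := @fekete R u.
- by move=> i; rewrite ln_ge0// ler1n card_lang_gt0.
- move=> i j; rewrite /u -lnM ?posrE ?ltr0n ?card_lang_gt0//.
  by rewrite ler_ln ?posrE ?mulr_gt0 ?ltr0n ?card_lang_gt0// -natrM ler_nat card_langD.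
Qed.

Variable mu : probability (borel X) R.
Hypothesis mu_inv : shift_invariant mu.

Let P := word_prob mu.
Let P_ge0 := word_prob_ge0 mu.
Let P_nil := word_prob_nil mu.
Let P_cons := sum_word_prob_cons mu_inv.
Let P_rcons := sum_word_prob_rcons mu.

Lemma entropy_le_block n : entropy mu * n%:R <= block_entropy P n.
Proof.
have [H _] := fekete (block_entropy_ge0 P_ge0 P_nil P_rcons)
  (block_entropyD P_ge0 P_nil P_cons P_rcons).
suff -> : entropy mu = limn (fun k : nat => k%:R^-1 * block_entropy P k) by [].
apply: (congr1 (fun f : nat -> R => limn f)); apply/funext => k; congr (_ * _).
rewrite /block_entropy /words big_map big_enum; apply: eq_bigr => w _.
by rewrite /P word_probE.
Qed.

(** The inequality for words of length N, divided by N.  Of the error 2 s^2, one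
    half comes from q exceeding e^h, the other from the factor linear in N in the
    count. *)
Lemma mme_occurrence_tradeoff m n (v : m.-tuple A) (w : n.-tuple A) (s t : R) :
  (0 < m)%N -> (0 < n)%N -> extender_set X v `<=` extender_set X w ->
  entropy mu = htop R X -> 0 < s ->
  t = s * exchange_rate (htop R X) m n s ->
  ln (1 + t / (1 + t) ^+ m) * P v <= ln (1 + s) * P w + s ^+ 2 * 2.
Proof.
move=> m0 n0 Evw mme s0; set h := htop R X => tE.
have s20 : 0 < s ^+ 2 by rewrite exprn_gt0.
have s1 : 0 < 1 + s by rewrite ltr_pwDl// ltW.
set q := expR (h + s ^+ 2).
have q0 : 0 < q by exact: expR_gt0.
have t0 : 0 <= t.
  by rewrite tE mulr_ge0// ?ltW// divr_gt0 ?mulr_gt0 ?exprn_gt0.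
have t1 : 0 < 1 + t by rewrite ltr_pwDl.
set t' := t / (1 + t) ^+ m.
have t'0 : 0 <= t' by rewrite divr_ge0// exprn_ge0// ltW.
have t'1 : 0 < 1 + t' by rewrite ltr_pwDl.
have [B HB] := lang_growth s20.
have [K HK] := ln_linear_le n s20.
(* Marked words over u, discounted by the occurrences of w. *)
pose g u : R := parse_weight v t u / (1 + s) ^+ occ w u.
have Zge u : (1 + t') ^+ occ v u <= parse_weight v t u.
  by have := parse_weight_ge v u t0; rewrite size_tuple.
have g0 u : 0 < g u.
  by rewrite divr_gt0 ?exprn_gt0// (lt_le_trans _ (Zge u))// exprn_gt0.
rewrite -subr_le0.
apply: (@linear_bound_le0 _ _ (B + K + ln (1 + t') * P v * m%:R)) => N.
have entN := entropy_le_block N; rewrite mme -/h in entN.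
have countN : \sum_(u <- words A N | in_lang X u) g u <=
    (N * n).+1%:R * (expR B * q ^+ N).
  have tE' : t = s * q ^+ size v / (q ^+ size w * (1 + s) ^+ (3 * size w)).
    by rewrite tE /exchange_rate !size_tuple mulrA.
  have v0 : (0 < size v)%N by rewrite size_tuple.
  have w0 : (0 < size w)%N by rewrite size_tuple.
  have HL p : in_lang X (fill v p) -> in_lang X (fill w p).
    exact: in_lang_fill Evw.
  apply: (le_trans (replacement_count N v0 w0 HL (ltW s0) q0 tE')).
  rewrite size_tuple mulr_natl -[X in _ <= _ *+ X]subn0 -sumr_const_nat.
  apply: ler_sum => l _.
  rewrite -big_filter big_const_seq count_predT iter_addr_0 -card_lang.
  rewrite -mulr_natl mulrCA mulrC ler_wpM2r ?(exprn_ge0 _ (ltW q0))//.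
  rewrite ler_pdivrMr ?exprn_gt0// -ler_ln ?posrE ?ltr0n ?card_lang_gt0//; last first.
    by rewrite mulr_gt0 ?exprn_gt0 ?expR_gt0.
  rewrite lnM ?posrE ?exprn_gt0 ?expR_gt0// /q -expRM_natr !expRK addrC.
  exact: HB.
have gain_ge : ln (1 + t') * (\sum_(u <- words A N) P u * (occ v u)%:R) -
    ln (1 + s) * (\sum_(u <- words A N) P u * (occ w u)%:R) <=
    \sum_(u <- words A N) P u * ln (g u).
  rewrite !mulr_sumr -sumrB; apply: ler_sum => u _.
  rewrite /g ln_div ?posrE ?exprn_gt0 ?(lt_le_trans _ (Zge u)) ?exprn_gt0//.
  have : ln (1 + t') * (occ v u)%:R <= ln (parse_weight v t u).
    rewrite mulr_natr -lnXn// ler_ln ?posrE ?exprn_gt0//.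
    by rewrite (lt_le_trans _ (Zge u)) ?exprn_gt0.
  rewrite lnXn// -[ln (1 + s) *+ _]mulr_natr; move: (P_ge0 u); rewrite -/P.
  by move: (P u) (ln (1 + t')) (ln (1 + s)) => *; nra.
move: gain_ge; rewrite !(expected_occ P_cons P_rcons) ?size_tuple// => gain_ge.
have occv : (N%:R + 1 - m%:R) * P v <= (N.+1 - m)%:R * P v.
  by rewrite ler_wpM2r// lerBlDr natr1 -natrD ler_nat addnC -leq_subLR.
have occw : (N.+1 - n)%:R * P w <= N%:R * P w.
  by rewrite ler_wpM2r// ler_nat leq_subLR -add1n leq_add2r.
have lnt : 0 <= ln (1 + t') by rewrite ln_ge0// lerDl.
have lns : 0 <= ln (1 + s) by rewrite ln_ge0// lerDl ltW.
have lncount : ln ((N * n).+1%:R * (expR B * q ^+ N)) <=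
    s ^+ 2 * N%:R + K + (B + (h + s ^+ 2) * N%:R).
  rewrite !lnM ?posrE ?mulr_gt0 ?ltr0n ?exprn_gt0 ?expR_gt0//.
  by rewrite expRK /q -expRM_natr expRK lerD2r HK.
have gibbsN := gibbs_variational P_ge0
  (sum_words1 P_nil P_rcons N) (@word_prob_in_lang _ _ _ mu) g0 countN.
have := ler_wpM2l lnt occv; have := ler_wpM2l lns occw.
have := mulr_ge0 lnt (P_ge0 v).
rewrite /block_entropy in entN.
move: gibbsN lncount entN gain_ge; rewrite -/P.
(* All bounds are now linear in N and in the two measures. *)
move: (\sum_(u <- _) _) (\sum_(u <- _) _) (ln (_ * _)) (ln (1 + t')) (ln (1 + s)).
move: (P v) (P w) ((N.+1 - m)%:R : R) ((N.+1 - n)%:R : R) (N%:R : R) (m%:R : R) (s ^+ 2).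
move=> pv pw Nm Nn x y d S1 S2 l a b *; lra.
Qed.

(** Divide [mme_occurrence_tradeoff] by s and let s tend to 0. *)
Lemma word_measure_le m n (v : m.-tuple A) (w : n.-tuple A) :
  (0 < m)%N -> (0 < n)%N -> extender_set X v `<=` extender_set X w ->
  entropy mu = htop R X ->
  word_measure mu v * expR (htop R X * (m%:R - n%:R)) <= word_measure mu w.
Proof.
move=> m0 n0 Evw mme; set h := htop R X.
rewrite -!word_probE -/P.
have lhs : P v * relative_gain h m n s @[s --> 0^'+] --> P v * expR (h * (m%:R - n%:R)).
  by apply: cvgM; [exact: cvg_cst|exact: relative_gain_cvg].
have rhs : P w + s * 2 @[s --> 0^'+] --> P w.
  have H : P w + s * 2 @[s --> 0^'+] --> P w + 0 * 2.
    apply: cvgD; first exact: cvg_cst.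
    by apply: cvgM; [apply: cvg_at_right_filter; exact: cvg_id|exact: cvg_cst].
  by rewrite mul0r addr0 in H.
apply: (ler_cvg_to lhs rhs); near=> s.
have s0 : 0 < s by near: s; exact: nbhs_right_gt.
have s1 : 0 < 1 + s by rewrite ltr_pwDl// ltW.
have r0 : 0 <= exchange_rate h m n s.
  by rewrite divr_ge0// ltW ?mulr_gt0 ?exprn_gt0 ?expR_gt0.
have t0 : 0 <= s * exchange_rate h m n s by rewrite mulr_ge0// ltW.
have H := mme_occurrence_tradeoff m0 n0 Evw mme s0 erefl; rewrite -/h in H.
rewrite -(ler_pM2l s0) /relative_gain.
set t := s * exchange_rate h m n s in t0 H *; set t' := t / (1 + t) ^+ m in H *.
have t'0 : 0 <= t' by rewrite divr_ge0// exprn_ge0// addr_ge0.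
have -> : s * (P v * (exchange_rate h m n s / (1 + t) ^+ m / (1 + t'))) =
    t' / (1 + t') * P v by rewrite /t' /t !mulrA; ring.
have lnt := ler_wpM2r (P_ge0 v) (ln1D_ge t'0).
have lns : ln (1 + s) * P w <= s * P w.
  by rewrite ler_wpM2r ?P_ge0// le_ln1Dx// (lt_trans _ s0).
by rewrite (le_trans lnt)// (le_trans H)//; lra.
Unshelve. all: by end_near. Qed.

End Main.

Theorem corollary3p12 (R : realType) (A : finType) (X : subshift A)
    (htop_gt0 : 0 < htop R X)
    (m n : nat) (m_ge1 : (1 <= m)%N) (n_ge1 : (1 <= n)%N)
    (v : m.-tuple A) (w : n.-tuple A)
    (vL : v \in lang X m) (wL : w \in lang X n)
    (Evw : extender_set X v = extender_set X w)
    (mu : probability (borel X) R) (mu_mme : is_mme mu) :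
  word_measure mu v =
  word_measure mu w * expR (htop R X * (n%:R - m%:R)).
Proof.
case: mu_mme => mu_inv mme; apply/eqP; rewrite eq_le; apply/andP; split.
  have Esub : extender_set X v `<=` extender_set X w by rewrite Evw.
  rewrite -ler_pdivrMr ?expR_gt0// -expRN -mulrN opprB.
  exact: word_measure_le.
have Esub : extender_set X w `<=` extender_set X v by rewrite Evw.
exact: word_measure_le.
Qed.
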